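(* There is a polynomial-time algorithm which, given any instance of weighted token swapping (on an arbitrary connected graph), outputs a valid sequence of swaps transforming the starting assignment into the destination assignment whose total cost is at most $\left(2+\frac{2W}{w}\right)\cdot\mathrm{OPT}$, where $w=\min_{t\in T}\omega(t)$, $W=\max_{t\in T}\omega(t)$, and $\mathrm{OPT}$ is the minimum cost of such a sequence.
   Context: An instance of weighted token swapping consists of a connected simple undirected graph $G=(V,E)$ with $n=|V|$ vertices, a set $T$ of $n$ tokens, a weight function $\omega:T\to\mathbb{R}_{>0}$, and two bijections $v_0,v_f:T\to V$ (starting and destination vertices). At all times each vertex holds exactly one token; initially token $t$ is on $v_0(t)$. A swap along an edge $(u,u')\in E$ exchanges the tokens on $u$ and $u'$ and costs the sum of the weights of the two swapped tokens. A valid solution is a sequence of swaps after which every token $t$ is on $v_f(t)$; its cost is the sum of the costs of its swaps. $\mathrm{OPT}$ denotes the minimum cost of a valid solution. *)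

(* Defs.v *)
From HB Require Import structures.
From mathcomp Require Import all_boot all_order all_algebra all_fingroup.
From mathcomp Require Import all_classical reals.

Set Implicit Arguments.
Unset Strict Implicit.
Unset Printing Implicit Defensive.

Import Order.TTheory GRing.Theory Num.Theory.

Local Open Scope ring_scope.
Local Open Scope classical_set_scope.

Definition is_min (R : realType) (A : set R) (m : R) : Prop := A m /\ lbound A m.
Definition is_max (R : realType) (A : set R) (m : R) : Prop := A m /\ ubound A m.

(** * Weighted token swapping *)

(* Bijectivity of v0 already forces #|token| = #|vertex|. *)
Record instance (R : realType) : Type := Instance {
  vertex : finType;
  edge : rel vertex;
  edge_sym : symmetric edge;
  edge_irr : irreflexive edge;
  edge_connected : forall x y : vertex, connect edge x y;
  vertex_nonempty : (0 < #|vertex|)%N;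
  token : finType;
  weight : token -> R;
  weight_gt0 : forall t, 0 < weight t;
  v0 : token -> vertex;
  vf : token -> vertex;
  v0_bij : bijective v0;
  vf_bij : bijective vf
}.

Arguments weight {R} i _.
Arguments v0 {R} i _.
Arguments vf {R} i _.

Section Swapping.
Context (R : realType) (I : instance R).
Implicit Types (c : token I -> vertex I) (e : vertex I * vertex I).
Implicit Type s : seq (vertex I * vertex I).

(* A configuration c sends each token to the vertex currently holding it. *)
Definition swap c e : token I -> vertex I := fun t => tperm e.1 e.2 (c t).

Definition swap_cost c e : R := \sum_(t | c t \in [:: e.1; e.2]) weight I t.

Fixpoint final c s : token I -> vertex I :=
  if s is e :: s' then final (swap c e) s' else c.

Fixpoint total_cost c s : R :=
  if s is e :: s' then swap_cost c e + total_cost (swap c e) s' else 0.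

Definition valid s : bool :=
  all (fun e => edge e.1 e.2) s && [forall t, final (v0 I) s t == vf I t].

Definition cost s : R := total_cost (v0 I) s.

Definition weights : set R := range (weight I).

Definition valid_costs : set R := [set cost s | s in [set s | valid s]].

End Swapping.

(** * Machine model

    Structured programs over a random access memory with two kinds of cells,
    natural numbers and reals, every command counting for one time unit.
    As the numerical operations are only addition, subtraction and comparison
    (no multiplication, no rounding of reals to integers), after t steps a
    natural cell holds O(t + log n) bits and a real cell holds an integer
    combination of 1 and the inputs whose coefficients have O(t) bits.  Hence
    polynomially many steps here mean polynomial time on a real RAM and, for
    rational inputs, polynomial time on a Turing machine.

    The first argument of a memory access is the name of an array, fixed by
    the program; indices are computed.  Scalars are cells of index 0. *)

Inductive nexpr : Type :=
| NConst of nat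
| NGet of nat & nexpr & nexpr
| NAdd of nexpr & nexpr
| NSub of nexpr & nexpr.

Inductive rexpr : Type :=
| RConst of nat
| RGet of nat & nexpr
| RAdd of rexpr & rexpr
| RSub of rexpr & rexpr.

Inductive bexpr : Type :=
| BNEq of nexpr & nexpr
| BNLe of nexpr & nexpr
| BRLe of rexpr & rexpr
| BNot of bexpr
| BAnd of bexpr & bexpr.

Inductive program : Type :=
| Skip
| NSet of nat & nexpr & nexpr & nexpr
| RSet of nat & nexpr & rexpr
| Emit of nexpr & nexpr
| Seq of program & program
| If of bexpr & program & program
| While of bexpr & program.

Section Semantics.
Variable R : realType.

Record state : Type := State {
  nmem : nat -> nat -> nat -> nat;
  rmem : nat -> nat -> R;
  output : seq (nat * nat)
}.

Implicit Types (st : state) (a i j k : nat).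

Fixpoint neval st (x : nexpr) : nat :=
  match x with
  | NConst k => k
  | NGet a x1 x2 => nmem st a (neval st x1) (neval st x2)
  | NAdd x1 x2 => (neval st x1 + neval st x2)%N
  | NSub x1 x2 => (neval st x1 - neval st x2)%N
  end.

Fixpoint reval st (x : rexpr) : R :=
  match x with
  | RConst k => k%:R
  | RGet a x1 => rmem st a (neval st x1)
  | RAdd x1 x2 => reval st x1 + reval st x2
  | RSub x1 x2 => reval st x1 - reval st x2
  end.

Fixpoint beval st (b : bexpr) : bool :=
  match b with
  | BNEq x1 x2 => neval st x1 == neval st x2
  | BNLe x1 x2 => (neval st x1 <= neval st x2)%N
  | BRLe x1 x2 => reval st x1 <= reval st x2
  | BNot b1 => ~~ beval st b1
  | BAnd b1 b2 => beval st b1 && beval st b2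
  end.

Definition nset st a i j k : state :=
  State (fun a' i' j' =>
           if [&& a' == a, i' == i & j' == j] then k else nmem st a' i' j')
        (rmem st) (output st).

Definition rset st a i (x : R) : state :=
  State (nmem st)
        (fun a' i' => if (a' == a) && (i' == i) then x else rmem st a' i')
        (output st).

Definition emit st i j : state :=
  State (nmem st) (rmem st) (rcons (output st) (i, j)).

(* [exec p st t st']: p started in st halts in st' after t time units. *)
Inductive exec : program -> state -> nat -> state -> Prop :=
| exec_Skip st : exec Skip st 1 st
| exec_NSet st a x y z :
    exec (NSet a x y z) st 1 (nset st a (neval st x) (neval st y) (neval st z))
| exec_RSet st a x z : exec (RSet a x z) st 1 (rset st a (neval st x) (reval st z))
| exec_Emit st x y : exec (Emit x y) st 1 (emit st (neval st x) (neval st y))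
| exec_Seq p1 p2 st t1 st1 t2 st2 :
    exec p1 st t1 st1 -> exec p2 st1 t2 st2 -> exec (Seq p1 p2) st (t1 + t2) st2
| exec_IfT b p1 p2 st t st' :
    beval st b -> exec p1 st t st' -> exec (If b p1 p2) st t.+1 st'
| exec_IfF b p1 p2 st t st' :
    ~~ beval st b -> exec p2 st t st' -> exec (If b p1 p2) st t.+1 st'
| exec_WhileF b p st : ~~ beval st b -> exec (While b p) st 1 st
| exec_WhileT b p st t1 st1 t2 st2 :
    beval st b -> exec p st t1 st1 -> exec (While b p) st1 t2 st2 ->
    exec (While b p) st (t1 + t2).+1 st2.

End Semantics.

(** * Input and output conventions

    Vertices and tokens are numbered from 0 in the order of [enum].  Initially
    natural array 0 holds the number of vertices, array 1 the adjacency matrix,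
    arrays 2 and 3 the starting and destination vertex of each token, and real
    array 0 the weight of each token; all other cells are 0. *)

Section Encoding.
Context (R : realType) (I : instance R).

Definition num (V : finType) (x : V) : nat := enum_rank x.

Definition input_nmem (a i j : nat) : nat :=
  match a, j with
  | 0, 0 => if i == 0%N then #|vertex I| else 0
  | 1, _ => nth 0 (nth [::] [seq [seq nat_of_bool (edge x y) | y <- enum (vertex I)]
                                 | x <- enum (vertex I)] i) j
  | 2, 0 => nth 0 [seq num (v0 I t) | t <- enum (token I)] i
  | 3, 0 => nth 0 [seq num (vf I t) | t <- enum (token I)] i
  | _, _ => 0
  end%N.

Definition input_rmem (a i : nat) : R :=
  if a == 0%N then nth 0 [seq weight I t | t <- enum (token I)] i else 0.

Definition input : state R := State input_nmem input_rmem [::].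

Definition encode_swaps (s : seq (vertex I * vertex I)) : seq (nat * nat) :=
  [seq (num e.1, num e.2) | e <- s].

End Encoding.

(** * The minimum cost exists *)

Section OptExists.
Context (R : realType) (I : instance R).
Notation V := (vertex I).
Notation T := (token I).
Implicit Types (c : T -> V) (s : seq (V * V)).

Let edges s := all (fun e => edge e.1 e.2) s.

Lemma final_cat c s1 s2 : final c (s1 ++ s2) = final (final c s1) s2.
Proof. by elim: s1 c => //= e s1 IH c; rewrite IH. Qed.

Lemma final_tperm (x y : V) :
  exists2 s, edges s & forall c t, final c s t = tperm x y (c t).
Proof.
have /connectP [p] := edge_connected x y.
elim/last_ind: p y => [|p z IH] y /=.
  by move=> _ ->; exists [::] => // c t; rewrite tperm1 perm1.
rewrite rcons_path last_rcons => /andP [xp exz] ->{y}.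
have [s Es Fs] := IH _ xp erefl.
set y := last x p in exz Fs.
have [->|xNz] := eqVneq x z.
  by exists [::] => // c t; rewrite tperm1 perm1.
have yNz : y != z by apply: contraTneq exz => ->; rewrite edge_irr.
have [xy|xNy] := eqVneq x y.
  by exists [:: (y, z)]; rewrite /edges /= ?exz // => c t; rewrite xy.
exists (s ++ (y, z) :: s).
  by rewrite /edges all_cat /= exz; move: Es; rewrite /edges => ->.
move=> c t; rewrite final_cat /= Fs /swap /= Fs.
rewrite tpermC -(tpermJ_tperm yNz xNz) ?(tpermC y x) /conjg tpermV !permM.
by [].
Qed.

Lemma valid_exists : exists s : seq (V * V), valid s.
Proof.
have [g v0K gK] := @v0_bij R I.
have inj : injective (vf I \o g).
  by apply: inj_comp; [exact: bij_inj (@vf_bij R I) | exact: can_inj gK].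
have [ts Ets _] := prod_tpermP (perm inj).
suff [s Es Fs] : exists2 s, edges s & forall c t, final c s t = perm inj (c t).
  exists s; apply/andP; split=> //.
  by apply/forallP => t; rewrite Fs permE /= v0K.
rewrite Ets; elim: ts {Ets} => [|[x y] ts [s Es Fs]].
  by exists [::] => // c t; rewrite big_nil perm1.
have [s' Es' Fs'] := final_tperm x y.
exists (s' ++ s); first by rewrite /edges all_cat; apply/andP.
by move=> c t; rewrite final_cat Fs Fs' big_cons permM.
Qed.

Lemma cost_size (w : R) c s : (forall t, w <= weight I t) -> bijective c ->
  w *+ size s <= total_cost c s.
Proof.
move=> wle; elim: s c => [|e s IH] c cbij //=.
rewrite mulrS lerD ?IH //; last first.
  by apply: (bij_comp _ cbij); exists (tperm e.1 e.2); exact: tpermK.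
have [g _ gK] := cbij.
rewrite /swap_cost (bigD1 (g e.1)) /= ?gK ?mem_head //.
by rewrite (le_trans (wle (g e.1))) // lerDl sumr_ge0 // => t _; apply: ltW (weight_gt0 _).
Qed.

Lemma opt_exists : exists m, is_min (valid_costs I) m.
Proof.
have [s0 s0v] := valid_exists.
have /card_gt0P [x0 _] := @vertex_nonempty R I.
have [g _ _] := @v0_bij R I; pose t0 := g x0.
have [w w_gt0 wle] : exists2 w : R, 0 < w & forall t : T, w <= weight I t.
  case: (@arg_minP _ _ _ t0 predT (weight I) isT) => t _ tmin.
  by exists (weight I t); [exact: weight_gt0 | move=> u; exact: tmin].
pose k := Num.bound `|cost s0 / w|.
have size_lt s : cost s <= cost s0 -> (size s <= k)%N.
  move=> sle; rewrite leqNgt; apply/negP => ks.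
  have := cost_size s wle (@v0_bij R I); apply/negP; rewrite -ltNge.
  apply: le_lt_trans sle _; rewrite -mulr_natl -ltr_pdivrMr //.
  apply: le_lt_trans (ler_norm _) _; apply: lt_trans (archi_boundP (normr_ge0 _)) _.
  by rewrite ltr_nat.
have s0k := size_lt _ (lexx _).
pose b0 : k.-bseq (V * V) := Bseq s0k.
case: (@arg_minP _ _ _ b0 (fun b : k.-bseq _ => valid b) (fun b => cost b) s0v) => b bv bmin.
exists (cost b); split; first by exists b.
move=> _ [s /= sv <-]; have [/size_lt sk|/ltW] := leP (cost s) (cost s0).
  exact: (bmin (Bseq sk)).
by apply: le_trans; exact: (bmin b0).
Qed.

End OptExists.

(* Main.v *)
Require Import Defs.
From mathcomp Require Import all_boot all_order all_algebra all_fingroup.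
From mathcomp Require Import all_classical reals.
From mathcomp Require Import zify lra.

(** Sort the permutation cycle by cycle, the lightest misplaced token b acting
    as the blank: while b is misplaced, exchange it with the token a whose
    destination is the vertex of b, by swaps forward and then backward along a
    shortest path of length l.  Every token inside the path is moved twice and
    restored, so the exchange costs at most l (w_a + w_b) + 2 (l - 1) W, hence at
    most l (2 w_a + 2 W).  Afterwards a rests forever, and a had not moved
    before, so l is its initial distance.  The sum of the weighted initial
    distances bounds OPT from below, because a swap moves each of its two tokens
    by one. *)

Set Implicit Arguments.
Unset Strict Implicit.
Unset Printing Implicit Defensive.

Import Order.TTheory GRing.Theory Num.Theory.
Local Open Scope ring_scope.

(** * Exchanges along shortest paths *)

Section Mathematics.
Context (R : realType) (I : instance R).
Notation V := (vertex I).
Notation T := (token I).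
Implicit Types (c : T -> V) (s : seq (V * V)) (t : T) (x y p : V).

Notation edges s := (all (fun e => edge e.1 e.2) s).

Lemma total_cost_cat c s1 s2 :
  total_cost c (s1 ++ s2) = total_cost c s1 + total_cost (final c s1) s2.
Proof. by elim: s1 c => [|e s1 IH] c /=; rewrite ?add0r // IH addrA. Qed.

Lemma final_bij c s : bijective c -> bijective (final c s).
Proof.
elim: s c => //= e s IH c cbij; apply: IH.
by apply: (bij_comp _ cbij); exists (tperm e.1 e.2); exact: tpermK.
Qed.

Lemma swap_cost_pair c a b x y : injective c -> x != y -> c a = x -> c b = y ->
  swap_cost c (x, y) = weight I a + weight I b.
Proof.
move=> cinj xy ca cb; rewrite /swap_cost (bigD1 a) /=; last by rewrite ca mem_head.
rewrite (bigD1 b) /=; last first.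
  rewrite cb !inE eqxx orbT /=; by apply: contra xy => /eqP ba; rewrite -ca -cb ba.
rewrite big1 ?addr0 // => t; rewrite !inE.
case/andP=> /andP[/orP[]/eqP E tNa] tNb.
  by case/eqP: tNa; apply: cinj; rewrite E.
by case/eqP: tNb; apply: cinj; rewrite E.
Qed.

(** The fields force [dist p x] to be the graph distance: the Lipschitz bound keeps it from
    exceeding that distance, and the [next] steps trace a walk of length [dist p x]. *)
Record distance_table (dist : V -> V -> nat) (next : V -> V -> V) : Prop := {
  dist_refl p : dist p p = 0%N;
  dist_lipschitz p x y : edge x y -> (dist p y <= (dist p x).+1)%N;
  next_edge p x : x != p -> edge x (next p x);
  next_dist p x : x != p -> dist p x = (dist p (next p x)).+1
}.

Section Tables.
Variables (dist : V -> V -> nat) (next : V -> V -> V).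
Hypothesis tab : distance_table dist next.

Definition forward p x l : seq (V * V) :=
  mkseq (fun i => (iter i (next p) x, iter i.+1 (next p) x)) l.

(** The way back omits the last edge, because the forward pass already leaves the token from [p] one
    step before [p]. *)
Definition path_swaps p x l : seq (V * V) := forward p x l ++ rev (forward p x l.-1).

Lemma forwardS p x l : forward p x l.+1 = (x, next p x) :: forward p (next p x) l.
Proof.
rewrite /forward /mkseq /= -[1%N]/(1 + 0)%N iotaDl -map_comp; congr cons.
by apply: eq_map => i; rewrite /comp /= -!iterSr.
Qed.

Lemma forwardSr p x l :
  forward p x l.+1 = rcons (forward p x l) (iter l (next p) x, iter l.+1 (next p) x).
Proof. exact: mkseqS. Qed.

(** Peeling off the first edge exhibits the sequence as a conjugate, by that edge, of the sequence
    for the shorter path; this drives the induction on length. *)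
Lemma path_swapsS p x l :
  path_swaps p x l.+2 = (x, next p x) :: rcons (path_swaps p (next p x) l.+1) (x, next p x).
Proof. by rewrite /path_swaps forwardS /= (forwardS p x l) rev_cons rcons_cat. Qed.

(** Conjugating [tperm y p] by [tperm x y] gives [tperm x p]. Each further inner vertex adds two
    swaps, one of its token with [a] and one with [b], at cost at most [w_a + w_b + 2 W]. *)
Lemma path_swapsP p x l c a b (W : R) :
  (forall t, weight I t <= W) -> bijective c -> dist p x = l.+1 -> c a = x -> c b = p ->
  [/\ edges (path_swaps p x l.+1),
      forall t, final c (path_swaps p x l.+1) t = tperm x p (c t)
    & total_cost c (path_swaps p x l.+1)
        <= (weight I a + weight I b) *+ l.+1 + (W *+ 2) *+ l].
Proof.
move=> Wmax; elim: l x c => [|l IH] x c cbij dx ca cb.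
all: have xNp : x != p by apply: contra_eq_neq dx => ->; rewrite (dist_refl tab).
all: have := next_dist tab xNp; have exy := next_edge tab xNp.
all: rewrite dx; set y := next p x in exy * => - [dy].
all: have xNy : x != y by apply: contraTneq exy => <-; rewrite edge_irr.
all: have cinj := bij_inj cbij.
- have yp : y = p.
    by apply/eqP; apply: contra_eqT dy => /(next_dist tab) ->.
  rewrite /path_swaps /forward /= -/y yp in exy xNy *; split => //=; first by rewrite exy.
  by rewrite mulr0n !addr0 (swap_cost_pair cinj xNy ca cb).
- have yNp : y != p by apply: contra_eq_neq dy => ->; rewrite (dist_refl tab).
  (* [z] is the token on the first inner vertex: the first swap parks it on [x], the last one
     returns it to [y]. *)
  have [g gK Kg] := cbij; pose z := g y; have cz : c z = y by exact: Kg.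
  have c'bij : bijective (swap c (x, y)).
    by apply: (@final_bij c [:: (x, y)]).
  have [||Es Fs Cs] := IH y (swap c (x, y)) c'bij (esym dy).
  + by rewrite /swap ca /= tpermL.
  + by rewrite /swap cb /= tpermD.
  rewrite path_swapsS -/y; move: (path_swaps p y l.+1) Es Fs Cs => s Es Fs Cs.
  split.
  + by rewrite /= all_rcons /= exy.
  + move=> t /=; rewrite -cats1 final_cat /=.
    rewrite -[LHS]/(tperm x y (final (swap c (x, y)) s t)) Fs /swap /=.
    by rewrite -(tpermJ_tperm yNp xNp) /conjg tpermV !permM (tpermC y x).
  + rewrite /= -cats1 total_cost_cat /= addr0.
    have -> : swap_cost (final (swap c (x, y)) s) (x, y) = weight I z + weight I b.
      apply: swap_cost_pair => //; first exact/bij_inj/final_bij.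
        by rewrite Fs /swap cz /= tpermR tpermD // eq_sym.
      by rewrite Fs /swap cb /= [tperm x y p]tpermD // tpermR.
    rewrite (swap_cost_pair cinj xNy ca cz).
    rewrite (mulrS (_ + _)) (mulrS (W *+ 2)).
    move: (_ *+ l.+1) (_ *+ l) Cs (Wmax z) => u v; rewrite mulr2n; lra.
Qed.

(** The weighted distance sum is a potential: when a swap brings a token one step closer, that
    token's share of the swap cost pays for the drop. Keeping the final potential on the right lets
    the induction run; it vanishes for valid sequences. *)
Lemma dist_lower_bound c s : edges s ->
  \sum_t weight I t * (dist (vf I t) (c t))%:R <=
  total_cost c s + \sum_t weight I t * (dist (vf I t) (final c s t))%:R.
Proof.
elim: s c => [|[x y] s IH] c /=; first by rewrite add0r.
case/andP=> exy es; rewrite -addrA.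
apply: (le_trans _ (lerD (lexx _) (IH _ es))).
rewrite /swap_cost [X in _ <= X + _]big_mkcond -big_split /=; apply: ler_sum => t _.
have w0 := ltW (weight_gt0 t).
case: ifP => ct; last first.
  move: ct; rewrite !inE => /negbT; rewrite negb_or => /andP[cx cy].
  by rewrite add0r /swap tpermD // eq_sym.
rewrite -[X in X + _]mulr1 -mulrDr ler_wpM2l // nat1r ler_nat.
move: ct; rewrite !inE /swap /= => /orP[] /eqP ->; rewrite ?tpermL ?tpermR.
  by apply: (dist_lipschitz tab); rewrite edge_sym.
exact: (dist_lipschitz tab).
Qed.

End Tables.
End Mathematics.

(** * Breadth-first search *)

Section BreadthFirstSearch.
Context (V : finType) (e : rel V).
Hypothesis e_connected : forall x y, connect e x y.
Implicit Types (p u v x y : V) (k : nat) (f g : V -> nat).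

(* [f v] is the distance from [v] to [p] plus one, or 0 if [v] has not been
   reached; [g v] is the number of the next vertex on a path from [v] to [p].
   In round [k], [scanned] tells which arcs have been examined. *)
Record bfs_inv p k (scanned : rel V) f g : Prop := {
  bfs_source : f p = 1%N;
  bfs_bound v : (f v <= k.+2)%N;
  bfs_next v : v != p -> (0 < f v)%N ->
    exists u, [/\ g v = num u, e u v, f v = (f u).+1 & (0 < f u)%N];
  bfs_done x y : e x y -> (0 < f x <= k)%N -> (0 < f y <= (f x).+1)%N;
  bfs_scanned x y : e x y -> f x = k.+1 -> scanned x y -> (0 < f y)%N
}.

Lemma bfs_init p f g : (forall v, f v = (v == p)) -> bfs_inv p 0 (fun _ _ => false) f g.
Proof.
move=> fE; split=> // [|v|v vp|x y _].
- by rewrite fE eqxx.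
- by rewrite fE; case: eqP.
- by rewrite fE (negbTE vp).
- by case: (f x).
Qed.

(** With all arcs examined, [bfs_scanned] supplies exactly what [bfs_done] lacks for level
    [k.+1]. *)
Lemma bfs_round p k (scanned : rel V) f g : (forall x y, scanned x y) ->
  bfs_inv p k scanned f g -> bfs_inv p k.+1 (fun _ _ => false) f g.
Proof.
move=> all_scanned [fp fb fn fd fs]; split=> // [v|x y exy /andP[f0 fk]].
  exact: leqW.
have [fxk|kfx] := leqP (f x) k; first by apply: fd; rewrite // f0.
have fx : f x = k.+1 by lia.
by rewrite (fs x y) //= fx fb.
Qed.

(** An arc may be marked as examined without any update if its tail is not on the current level or
    its head is already reached. *)
Lemma bfs_scan_sub p k (scanned scanned' : rel V) f g :
  (forall x y, f x = k.+1 -> e x y -> scanned' x y -> scanned x y || (0 < f y)%N) ->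
  bfs_inv p k scanned f g -> bfs_inv p k scanned' f g.
Proof.
move=> sub [fp fb fn fd fs]; split=> // x y exy fx /(sub _ _ fx exy).
by case/orP => // ?; apply: fs exy fx _.
Qed.

Lemma bfs_visit p k (scanned scanned' : rel V) f g f' g' u v :
  bfs_inv p k scanned f g -> e u v -> f u = k.+1 -> f v = 0%N ->
  (forall x, f' x = if x == v then k.+2 else f x) ->
  (forall x, g' x = if x == v then num u else g x) ->
  (forall x y, scanned' x y -> scanned x y || (y == v)) ->
  bfs_inv p k scanned' f' g'.
Proof.
move=> [fp fb fn fd fs] euv fu fv f'E g'E sub.
have uv : u != v by apply: contra_eq_neq fu => ->; rewrite fv.
split=> [|x|x xp|x y exy|x y exy].
- by rewrite f'E; case: eqP => // pv; move: fp; rewrite pv fv.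
- by rewrite f'E; case: ifP.
- rewrite f'E g'E; have [-> _|xv f0] := eqVneq x v.
    by exists u; rewrite euv f'E (negbTE uv) fu.
  have [w [gx ewx fx fw]] := fn x xp f0.
  exists w; rewrite gx ewx f'E; case: eqP => [wv|//].
  by move: fw; rewrite wv fv.
- rewrite !f'E; have [_|xv fxk] := eqVneq x v; first by lia.
  case: eqP => [yv|_]; last exact: fd.
  (* A vertex of level at most [k] has only reached neighbours, so the unreached [v] is not among
     them. *)
  by have := fd x y exy fxk; rewrite yv fv.
- rewrite !f'E; have [_|xv fx /sub] := eqVneq x v; first by lia.
  by case: eqP => // _; rewrite orbF => /(fs x y exy fx).
Qed.

(** The predecessors recorded in [g] descend one level at a time to the source, so levels have no
    gaps. *)
Lemma bfs_levels p k (scanned : rel V) f g v m : bfs_inv p k scanned f g ->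
  (0 < m <= f v)%N -> exists x, f x = m.
Proof.
case=> fp _ fn _ _; move E: (f v) => j; elim: j v E => [|j IH] v fv; first by case: m.
case/andP=> m0; rewrite leq_eqVlt ltnS => /orP[/eqP ->|mj]; first by exists v.
have [vp|vp] := eqVneq v p.
  by move: fv mj; rewrite vp fp => -[<-]; rewrite leqNgt m0.
have [u [_ _ fvu f0]] : exists u, [/\ g v = num u, e u v, f v = (f u).+1 & (0 < f u)%N].
  by apply: fn; rewrite ?fv.
by apply: (IH u) => //; [move: fvu; rewrite fv => -[] | rewrite m0].
Qed.

(** All of 1, ..., [f v] are values of [f], which takes at most [#|V|] values. Hence [#|V|] rounds
    exhaust the search. *)
Lemma bfs_le_card p k (scanned : rel V) f g v : bfs_inv p k scanned f g -> (f v <= #|V|)%N.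
Proof.
move=> inv; rewrite -[X in (X <= _)%N](size_iota 1) -(size_codom f).
apply: uniq_leq_size; first exact: iota_uniq.
move=> m; rewrite mem_iota add1n ltnS => /(bfs_levels inv) [x <-].
exact: codom_f.
Qed.

Definition bfs_table p f g : Prop :=
  [/\ f p = 1%N, (forall v, 0 < f v <= #|V|)%N,
      (forall x y, e x y -> f y <= (f x).+1)%N
    & (forall v, v != p -> exists u, [/\ g v = num u, e u v & f v = (f u).+1])].

Lemma bfs_final p (scanned : rel V) f g :
  bfs_inv p #|V| scanned f g -> bfs_table p f g.
Proof.
move=> inv; have le_card v := bfs_le_card v inv; have [fp _ fn fd _] := inv.
(* Being reached spreads along a path from [p]: every reached vertex has level at most [#|V|], so
   [bfs_done] applies to it. *)
have fpos v : (0 < f v)%N.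
  have /connectP [q pq ->] := e_connected p v.
  have : (0 < f p)%N by rewrite fp.
  elim: q (p) pq => //= y q IH x /andP[exy yq] f0; apply: IH => //.
  by have /andP[] : (0 < f y <= (f x).+1)%N by apply: fd; rewrite // f0 le_card.
split=> // [v|x y exy|v vp]; first by rewrite fpos le_card.
  by have /andP[] : (0 < f y <= (f x).+1)%N by apply: fd; rewrite // fpos le_card.
by have [u [? ? ? _]] := fn v vp (fpos v); exists u.
Qed.

End BreadthFirstSearch.

(** * Programs with bounded running time *)

Section Hoare.
Variable R : realType.
Implicit Types (st : state R) (Q : state R -> Prop).

Definition halts_within (p : program) (T : nat) st Q : Prop :=
  exists t st', [/\ exec p st t st', (t <= T)%N & Q st'].

Lemma halts_weaken p T T' st Q Q' : (T <= T')%N -> (forall st', Q st' -> Q' st') ->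
  halts_within p T st Q -> halts_within p T' st Q'.
Proof.
move=> TT' QQ' [t [st' [ex tT q]]]; exists t, st'; split=> //; last exact: QQ'.
exact: leq_trans TT'.
Qed.

Lemma halts_Skip st Q : Q st -> halts_within Skip 1 st Q.
Proof. by move=> q; exists 1%N, st; split=> //; constructor. Qed.

Lemma halts_NSet a x y z st Q :
  Q (nset st a (neval st x) (neval st y) (neval st z)) ->
  halts_within (NSet a x y z) 1 st Q.
Proof. by move=> q; do 2!eexists; split; [constructor | | exact: q]. Qed.

Lemma halts_Emit x y st Q :
  Q (emit st (neval st x) (neval st y)) -> halts_within (Emit x y) 1 st Q.
Proof. by move=> q; do 2!eexists; split; [constructor | | exact: q]. Qed.

Lemma halts_Seq p1 p2 T1 T2 st Q :
  halts_within p1 T1 st (fun st1 => halts_within p2 T2 st1 Q) ->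
  halts_within (Seq p1 p2) (T1 + T2) st Q.
Proof.
move=> [t1 [st1 [e1 le1 [t2 [st2 [e2 le2 q]]]]]]; exists (t1 + t2)%N, st2.
by split; [exact: exec_Seq e1 e2 | exact: leq_add | ].
Qed.

Lemma halts_If b p1 p2 T st Q :
  (beval st b -> halts_within p1 T st Q) -> (~~ beval st b -> halts_within p2 T st Q) ->
  halts_within (If b p1 p2) T.+1 st Q.
Proof.
move=> h1 h2; have [/[dup] cond /h1|/[dup] cond /h2] := boolP (beval st b).
  by move=> [t [st' [ex le q]]]; exists t.+1, st'; split=> //; exact: exec_IfT.
by move=> [t [st' [ex le q]]]; exists t.+1, st'; split=> //; exact: exec_IfF.
Qed.

Definition cell a : nexpr := NGet a (NConst 0) (NConst 0).
Definition set_cell a (x : nexpr) : program := NSet a (NConst 0) (NConst 0) x.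

Definition For c (bound : nexpr) (body : program) : program :=
  Seq (set_cell c (NConst 0))
      (While (BNot (BNLe bound (cell c)))
             (Seq body (set_cell c (NAdd (cell c) (NConst 1))))).

(** [N] bounds the actual number [n] of iterations, so the time does not depend on data such as path
    lengths. Test and increment cost 2 per iteration; the initialisation and the last test are
    absorbed by the other 2, since [N] is positive. The invariant must tolerate writes to the
    counter. *)
Lemma halts_For (Inv : nat -> state R -> Prop) n N c bound body T st Q :
  (0 < N)%N -> (n <= N)%N ->
  (forall i st, Inv i st -> neval st bound = n) ->
  (forall i k st, Inv i st -> Inv i (nset st c 0 0 k)) ->
  (forall i st, (i < n)%N -> Inv i st -> nmem st c 0 0 = i ->
     halts_within body T st (fun st' => Inv i.+1 st' /\ nmem st' c 0 0 = i)) ->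
  Inv 0%N st -> (forall st', Inv n st' -> Q st') ->
  halts_within (For c bound body) (N * (T + 4)) st Q.
Proof.
move=> N0 nN boundE stable step inv0 post.
have loop m i st1 : (i + m = n)%N -> Inv i st1 -> nmem st1 c 0 0 = i ->
    halts_within (While (BNot (BNLe bound (cell c)))
             (Seq body (set_cell c (NAdd (cell c) (NConst 1))))) (m * (T + 2) + 1) st1 Q.
  elim: m i st1 => [|m IH] i st1 im inv ci.
    exists 1%N, st1; split=> //; last by apply: post; rewrite -im addn0.
    by apply: exec_WhileF; rewrite /= (boundE _ _ inv) ci -im addn0 leqnn.
  have [|t [st2 [ex le [inv2 c2]]]] := step i st1 _ inv ci; first by lia.
  pose st3 := nset st2 c 0 0 (i + 1).
  have [||t' [st4 [ex' le' q]]] := IH i.+1 st3 _ (stable _ _ _ inv2); first by lia.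
    by rewrite /= !eqxx addn1.
  exists (t + 1 + t').+1, st4; split=> //; last by lia.
  apply: exec_WhileT ex'; first by rewrite /= (boundE _ _ inv) ci; lia.
  apply: exec_Seq ex _; rewrite /st3 -{1}c2; exact: exec_NSet.
apply: (@halts_weaken _ (1 + (n * (T + 2) + 1)) _ _ Q) => //; first by nia.
apply/halts_Seq/halts_NSet/(loop n 0%N) => //; first exact: stable.
by rewrite /= !eqxx.
Qed.

End Hoare.

(** * Progress of the sorting process *)

Section Progress.
Context (R : realType) (I : instance R).
Notation V := (vertex I).
Notation T := (token I).
Notation edges s := (all (fun e => edge e.1 e.2) s).
Variables (dist : V -> V -> nat) (next : V -> V -> V).
Hypothesis tab : distance_table dist next.
Implicit Types (c : T -> V) (s : seq (V * V)) (a b t : T).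

(* Ties between weights are broken by number, so that the chosen token stays
   the lightest misplaced one until it reaches its destination. *)
Definition lighter a b : bool :=
  (weight I a < weight I b) || (weight I a == weight I b) && (num a <= num b)%N.

Lemma num_inj (A : finType) : injective (@num A).
Proof. by move=> x y /ord_inj /enum_rank_inj. Qed.

Lemma lighter_weight a b : lighter a b -> weight I a <= weight I b.
Proof. by case/orP=> [/ltW //|/andP[/eqP -> _]]. Qed.

Lemma lighter_anti a b : lighter a b -> lighter b a -> a = b.
Proof.
rewrite /lighter => /orP[ab|/andP[/eqP <- ab]] /orP[ba|/andP[/eqP E ba]].
- by move: (lt_trans ab ba); rewrite ltxx.
- by move: ab; rewrite E ltxx.
- by move: ba; rewrite ltxx.
- by apply: num_inj; apply/eqP; rewrite eqn_leq ab ba.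
Qed.

Definition misplaced c t : bool := c t != vf I t.

Definition lightest c b : Prop :=
  misplaced c b /\ forall t, misplaced c t -> lighter b t.

(** The budget for bringing [t] home, spent once, on its arrival. *)
Definition charge (W : R) t : R := (2 * weight I t + 2 * W) * (dist (vf I t) (v0 I t))%:R.

(** The crucial field is [progress_moved]: a misplaced token other than the lightest still stands
    where it started, so its current distance is the one it is charged for. *)
Record progress s (i : nat) : Prop := {
  progress_edges : edges s;
  progress_count : (#|misplaced (final (v0 I) s)| + i <= #|T|)%N;
  progress_moved t : misplaced (final (v0 I) s) t -> final (v0 I) s t != v0 I t ->
    lightest (final (v0 I) s) t;
  progress_cost (W : R) : (forall t, weight I t <= W) ->
    cost s <= \sum_(t | ~~ misplaced (final (v0 I) s) t) charge W t
}.

Lemma weight_le_sum t : weight I t <= \sum_u weight I u.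
Proof. by rewrite (bigD1 t) //= lerDl sumr_ge0 // => u _; exact/ltW/weight_gt0. Qed.

Lemma charge_ge0 W t : (forall t, weight I t <= W) -> 0 <= charge W t.
Proof.
move=> Wmax; apply: mulr_ge0 => //.
by have := weight_gt0 t; have := Wmax t; lra.
Qed.

Lemma progress0 : progress [::] 0.
Proof.
split=> //= [|t _ /eqP //|W Wmax]; first by rewrite addn0 max_card.
by apply: sumr_ge0 => t _; exact: charge_ge0.
Qed.

(** The number of rounds is fixed, so rounds after the sorting is complete must also preserve the
    invariant. *)
Lemma progress_idle s i : (forall t, ~~ misplaced (final (v0 I) s) t) -> (i < #|T|)%N ->
  progress s i -> progress s i.+1.
Proof.
move=> home iT [es cs ms ks]; split=> //.
suff -> : #|misplaced (final (v0 I) s)| = 0%N by [].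
by apply: eq_card0 => t; exact/negbTE/home.
Qed.

Lemma progress_step s i a b (c := final (v0 I) s) :
    lightest c b -> vf I a = c b -> progress s i ->
  let s' := s ++ path_swaps next (c b) (c a) (dist (c b) (c a)) in
  progress s' i.+1 /\ forall t, final (v0 I) s' t = tperm (c a) (c b) (c t).
Proof.
move=> [mb bmin] ab [es cs ms ks] s'.
have cbij : bijective c by apply: final_bij; exact: v0_bij.
have cinj := bij_inj cbij.
have ba : b != a by apply: contraTneq mb => ba; rewrite /misplaced -ab ba eqxx.
have cba : c a != c b by rewrite (inj_eq cinj) eq_sym.
have ma : misplaced c a by rewrite /misplaced ab.
(* Had [a] moved, it would itself be lightest, hence equal to [b] by antisymmetry. *)
have ca0 : c a = v0 I a.
  apply/eqP/negPn/negP => /(ms _ ma) [_ amin]; case/eqP: ba.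
  by apply: lighter_anti; [exact: bmin | exact: amin].
have wba := lighter_weight (bmin a ma).
have [l dl] : exists l, dist (c b) (c a) = l.+1 by rewrite (next_dist tab cba); eexists.
have path W (Wmax : forall t, weight I t <= W) := path_swapsP tab Wmax cbij dl erefl erefl.
have Fs t : final (v0 I) s' t = tperm (c a) (c b) (c t).
  rewrite /s' final_cat dl.
  (* The positions do not involve [W]; any upper bound on the weights, here their sum, gives access
     to them. *)
  by have [|_ ->] := path (\sum_t weight I t); first exact: weight_le_sum.
have Fo t : t != a -> t != b -> final (v0 I) s' t = c t.
  by move=> ta tb; rewrite Fs tpermD // (inj_eq cinj) eq_sym.
have mis t : misplaced (final (v0 I) s') t -> misplaced c t && (t != a).
  have [->|ta] := eqVneq t a; first by rewrite /misplaced Fs tpermL ab eqxx.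
  have [-> //|tb] := eqVneq t b; first by rewrite mb.
  by rewrite /misplaced Fo // => ->.
have card : (#|misplaced (final (v0 I) s')| < #|misplaced c|)%N.
  apply/proper_card/properP; split; first by apply/fintype.subsetP => t /mis /andP[].
  by exists a => //; apply/negP => /mis /andP[_ /eqP].
split=> //; split=> [||t mt|W Wmax].
- rewrite /s' all_cat es dl; have [|-> //] := path (\sum_t weight I t); exact: weight_le_sum.
- by apply: leq_trans cs; rewrite addnS -addSn leq_add2r.
- have /andP[mct ta] := mis t mt; have [tb|tb] := eqVneq t b.
    by move=> _; rewrite tb in mt *; split=> // u /mis /andP[mu _]; exact: bmin.
  rewrite Fo // => moved; have [_ tmin] := ms t mct moved.
  by split=> // u /mis /andP[mu _]; exact: tmin.
- have [_ _ Cs] := path W Wmax.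
  rewrite /cost total_cost_cat -/c dl (bigD1 a); last first.
    by rewrite /= /misplaced Fs tpermL ab eqxx.
  rewrite [X in X <= _]addrC; apply: lerD.
    (* With [w_b <= w_a], the cost [(w_a + w_b) (l + 1) + 2 W l] fits into the charge
       [(2 w_a + 2 W) (l + 1)] of [a]. *)
    apply: (le_trans Cs); rewrite /charge -ca0 ab dl mulr_natr.
    have W0 : 0 < W := lt_le_trans (weight_gt0 a) (Wmax a).
    rewrite [X in _ <= X]mulrnDl; apply: lerD; first by rewrite lerMn2r orFb; lra.
    apply: (@le_trans _ _ ((W *+ 2) *+ l.+1)); last by rewrite mulr_natl.
    by rewrite [X in _ <= X]mulrSr lerDl mulrn_wge0 // ltW.
  apply: (le_trans (ks W Wmax)).
  (* Among the tokens other than [a] that are home now, those home before yield the old sum exactly;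
     the rest, at most [b], add a nonnegative charge. *)
  rewrite [X in _ <= X](bigID (fun t => ~~ misplaced c t)) /=.
  rewrite -[X in X <= _]addr0; apply: lerD.
    rewrite le_eqVlt; apply/orP; left; apply/eqP/eq_bigl => t.
    have [_|mct] := boolP (misplaced c t); first by rewrite andbF.
    rewrite andbT; have -> : t != a by apply: contraNneq mct => ->.
    by rewrite andbT; apply/esym; apply: contra mct => /mis /andP[].
  by apply: sumr_ge0 => t _; exact: charge_ge0.
Qed.

(** The count forces every token home. Since [w <= w_t], each factor [2 w_t + 2 W] is at most
    [(2 + 2 W / w) w_t], and the lower bound by weighted distances applies to an optimal
    sequence. *)
Lemma progress_final s : progress s #|T| ->
  valid s /\ forall w W OPT : R,
    is_min (weights I) w -> is_max (weights I) W -> is_min (valid_costs I) OPT ->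
    cost s <= (2 + 2 * W / w) * OPT.
Proof.
case=> es cs _ ks.
have home t : final (v0 I) s t = vf I t.
  apply/eqP; move: cs; rewrite -[X in (_ <= X)%N]add0n leq_add2r leqn0 => /eqP /card0_eq.
  by move=> /(_ t); rewrite /in_mem /= => /negPn.
split; first by rewrite /valid es /=; apply/forallP => t; apply/eqP.
move=> w W OPT [[tw _ <-] wmin] [_ Wmax] [[s0 /andP[es0 /forallP home0] <-] _].
have Wmax' t : weight I t <= W by apply: Wmax; exists t.
have wmin' t : weight I tw <= weight I t by apply: wmin; exists t.
have w0 := weight_gt0 tw.
have lb := dist_lower_bound tab (v0 I) es0.
rewrite (_ : \sum_t weight I t * (dist (vf I t) (final (v0 I) s0 t))%:R = 0) in lb; last first.
  by rewrite big1 // => t _; rewrite (eqP (home0 t)) (dist_refl tab) mulr0.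
rewrite addr0 in lb; have W0 : 0 < W := lt_le_trans w0 (Wmax' tw).
apply: (le_trans (ks W Wmax')).
apply: (@le_trans _ _ ((2 + 2 * W / weight I tw) *
    \sum_t weight I t * (dist (vf I t) (v0 I t))%:R)); last first.
  have r0 : 0 <= 2 * W / weight I tw by rewrite divr_ge0 ?mulr_ge0 // ltW.
  by rewrite ler_wpM2l // addr_ge0.
rewrite mulr_sumr big_mkcond /=; apply: ler_sum => t _.
rewrite /misplaced home eqxx /charge mulrA ler_wpM2r //.
have : W <= W / weight I tw * weight I t.
  by rewrite mulrAC ler_pdivlMr // ler_pM2l.
by rewrite -(mulrA 2 W); lra.
Qed.

End Progress.

(** * The program *)

(* Row [p] of arrays 4 and 5 receives the distances to [p] plus one and the
   next vertices on the way to [p]; 0 marks a vertex not yet reached. *)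
Definition fill_tables : program :=
  For 6 (cell 0)
   (Seq (NSet 4 (cell 6) (cell 6) (NConst 1))
    (For 7 (cell 0) (For 8 (cell 0) (For 9 (cell 0)
      (If (BAnd (BAnd (BNEq (NGet 4 (cell 6) (cell 8)) (NAdd (cell 7) (NConst 1)))
                      (BNEq (NGet 1 (cell 8) (cell 9)) (NConst 1)))
                (BNEq (NGet 4 (cell 6) (cell 9)) (NConst 0)))
          (Seq (NSet 4 (cell 6) (cell 9) (NAdd (cell 7) (NConst 2)))
               (NSet 5 (cell 6) (cell 9) (cell 8)))
          Skip))))).

Definition vec a (x : nexpr) : nexpr := NGet a x (NConst 0).

(* Cells 10 and 12 hold the lightest misplaced token and its partner, cell 16 the
   vertex of the former, array 13 the path between them.  Cell 10 contains the
   number of vertices if no token is misplaced. *)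
Definition find_lightest : program :=
  Seq (set_cell 10 (cell 0))
      (For 11 (cell 0)
        (If (BAnd (BNot (BNEq (vec 2 (cell 11)) (vec 3 (cell 11))))
                  (BNot (BAnd (BNot (BNEq (cell 10) (cell 0)))
                              (BRLe (RGet 0 (cell 10)) (RGet 0 (cell 11))))))
            (set_cell 10 (cell 11))
            Skip)).

Definition find_partner : program :=
  For 11 (cell 0)
    (If (BNEq (vec 3 (cell 11)) (cell 16)) (set_cell 12 (cell 11)) Skip).

(** Array 4 stores distance plus one, so for a path of length l the value [len] is l + 1: the loops
    make l and l - 1 swaps, and backward swap i joins path vertices l - 2 - i and l - 1 - i. *)
Definition emit_path : program :=
  let len := NGet 4 (cell 16) (vec 2 (cell 12)) in
  Seq (NSet 13 (NConst 0) (NConst 0) (vec 2 (cell 12)))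
  (Seq (For 14 (NSub len (NConst 1))
    (Seq (NSet 13 (NAdd (cell 14) (NConst 1)) (NConst 0)
               (NGet 5 (cell 16) (vec 13 (cell 14))))
         (Emit (vec 13 (cell 14)) (vec 13 (NAdd (cell 14) (NConst 1))))))
   (For 14 (NSub len (NConst 2))
     (Emit (vec 13 (NSub len (NAdd (NConst 3) (cell 14))))
           (vec 13 (NSub len (NAdd (NConst 2) (cell 14))))))).

(** Cell 16 saves the old vertex of the blank, whose entry in array 2 is overwritten before that of
    the partner. *)
Definition place_partner : program :=
  Seq (set_cell 16 (vec 2 (cell 10)))
  (Seq find_partner
  (Seq emit_path
  (Seq (NSet 2 (cell 10) (NConst 0) (vec 2 (cell 12)))
       (NSet 2 (cell 12) (NConst 0) (cell 16))))).

Definition token_swapping : program :=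
  Seq fill_tables
      (For 17 (cell 0)
           (Seq find_lightest
                (If (BNEq (cell 10) (cell 0)) Skip place_partner))).

Section Numbering.
Variable A : finType.
Implicit Types x y : A.

Lemma num_lt x : (num x < #|A|)%N.
Proof. exact: ltn_ord. Qed.

Lemma num_surj i : (i < #|A|)%N -> exists x, num x = i.
Proof. by move=> iA; exists (enum_val (Ordinal iA)); rewrite /num enum_valK. Qed.

Lemma nth_num S (s0 : S) (F : A -> S) x : nth s0 [seq F y | y <- enum A] (num x) = F x.
Proof. by rewrite (nth_map x) ?nth_enum_rank // -cardE ltn_ord. Qed.

Lemma num_eq x y : (num x == num y) = (x == y).
Proof. exact: (inj_eq (@num_inj A)). Qed.

End Numbering.

(** * Memory contents and correctness of the distance tables *)

Section Correctness.
Context (R : realType) (I : instance R).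
Notation V := (vertex I).
Notation T := (token I).
Implicit Types (st : state R) (c : T -> V) (out : seq (nat * nat)).
Implicit Types (p u v x y : V) (a b t : T).

Let n := #|V|.

Lemma card_token : #|T| = n.
Proof. exact/bij_eq_card/v0_bij. Qed.

Lemma num_token_lt t : (num t < n)%N.
Proof. by rewrite -[X in (_ < X)%N]card_token num_lt. Qed.

Lemma num_token_surj i : (i < n)%N -> exists t, num t = i.
Proof. by rewrite -[X in (_ < X)%N]card_token; exact: num_surj. Qed.

Lemma n_gt0 : (0 < n)%N.
Proof. exact: vertex_nonempty. Qed.

(** Array 2 holds the current positions [c], which are the starting ones only at first. *)
Record loaded c out st : Prop := {
  loaded_size : nmem st 0 0 0 = n;
  loaded_edge x y : nmem st 1 (num x) (num y) = edge x y;
  loaded_pos t : nmem st 2 (num t) 0 = num (c t);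
  loaded_dest t : nmem st 3 (num t) 0 = num (vf I t);
  loaded_weight t : rmem st 0 (num t) = weight I t;
  loaded_output : output st = out
}.

Lemma loaded_input : loaded (v0 I) [::] (input I).
Proof.
split=> //=.
- by move=> x y; rewrite !nth_num.
- by move=> t; rewrite nth_num.
- by move=> t; rewrite nth_num.
- by move=> t; rewrite /input_rmem /= nth_num.
Qed.

Lemma loaded_nset m i j k c out st : (3 < m)%N ->
  loaded c out st -> loaded c out (nset st m i j k).
Proof.
move=> m3 [h0 h1 h2 h3 hw ho].
by split=> //= *; rewrite ltn_eqF ?h0 ?h1 ?h2 ?h3 //; apply: leq_trans m3.
Qed.

Definition entry st m p v : nat := nmem st m (num p) (num v).

Section FillTables.
Variables (c : T -> V) (out : seq (nat * nat)).

(** Comparing the other rows with [st0] preserves both the finished rows and the zeros of those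
    still to come. *)
Definition in_row p st0 k (scanned : rel V) st : Prop :=
  [/\ loaded c out st, nmem st 6 0 0 = num p,
      (forall q v, q != p -> entry st 4 q v = entry st0 4 q v /\ entry st 5 q v = entry st0 5 q v)
    & bfs_inv (@edge R I) p k scanned (entry st 4 p) (entry st 5 p)].

Lemma in_row_nset m i j l p st0 k scanned st : (6 < m)%N ->
  in_row p st0 k scanned st -> in_row p st0 k scanned (nset st m i j l).
Proof.
move=> m6 [h1 h2 h3 h4]; have E m' : (m' <= 6)%N -> (m' == m) = false by lia.
split; first by apply: loaded_nset; first lia.
- by rewrite /= E.
- by move=> q v qp; rewrite /entry /= !E //; exact: h3.
- have -> : entry (nset st m i j l) 4 p = entry st 4 p by apply/funext => v; rewrite /entry /= E.
  by have -> : entry (nset st m i j l) 5 p = entry st 5 p by apply/funext => v; rewrite /entry /= E.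
Qed.

Lemma in_row_weaken p st0 k k' (scanned scanned' : rel V) st :
  (bfs_inv (@edge R I) p k scanned (entry st 4 p) (entry st 5 p) ->
   bfs_inv (@edge R I) p k' scanned' (entry st 4 p) (entry st 5 p)) ->
  in_row p st0 k scanned st -> in_row p st0 k' scanned' st.
Proof. by move=> h [h1 h2 h3 h4]; split=> //; exact: h. Qed.

Definition scan i : rel V := fun x _ => (num x < i)%N.
Definition scan2 i j : rel V := fun x y => (num x < i)%N || (num x == i) && (num y < j)%N.

Definition fill_tables_time : nat :=
  n * (1 + n * (n * (n * (3 + 4) + 4) + 4) + 4).

Lemma halts_fill_tables st (Q : state R -> Prop) : loaded c out st ->
  (forall p v, entry st 4 p v = 0%N) ->
  (forall st', loaded c out st' ->
     (forall p, bfs_table (@edge R I) p (entry st' 4 p) (entry st' 5 p)) -> Q st') ->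
  halts_within fill_tables fill_tables_time st Q.
Proof.
move=> ld zero post.
apply: (halts_For (n := n) (Inv := fun i st => [/\ loaded c out st,
    forall p, (num p < i)%N -> bfs_table (@edge R I) p (entry st 4 p) (entry st 5 p)
    & forall p v, (i <= num p)%N -> entry st 4 p v = 0%N])) => //; first exact: n_gt0.
- by move=> i st1 [/loaded_size].
- by move=> i k st1 [h1 h2 h3]; split=> //; exact: loaded_nset.
- move=> i st0 /num_surj [p <-] [ld0 done0 zero0] c6.
  apply/halts_Seq/halts_NSet; rewrite /= c6.
  apply: (halts_For (n := n) (Inv := fun k st => in_row p st0 k (fun _ _ => false) st)) => //.
  + exact: n_gt0.
  + by move=> k st1 [/loaded_size].
  + by move=> k l st1; exact: in_row_nset.
  + move=> k st1 _ /= inv1 c7.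
    apply: (halts_For (n := n) (Inv := fun iu st => in_row p st0 k (scan iu) st /\ nmem st 7 0 0 = k)) => //.
    * exact: n_gt0.
    * by move=> iu st2 [[/loaded_size]].
    * by move=> iu l st2 [h1 h2]; split=> //; exact: in_row_nset.
    * move=> iu st2 /num_surj [u <-] [inv2 {}c7] c8.
      apply: (halts_For (n := n) (Inv := fun iv st =>
         [/\ in_row p st0 k (scan2 (num u) iv) st, nmem st 7 0 0 = k & nmem st 8 0 0 = num u])) => //.
      - exact: n_gt0.
      - by move=> iv st3 [[/loaded_size]].
      - by move=> iv l st3 [h1 h2 h3]; split=> //; exact: in_row_nset.
      - move=> iv st3 /num_surj [v <-] [[ld3 c6' oth3 inv3] {}c7 {}c8] c9.
        apply: halts_If; rewrite /= c6' c7 c8 c9 (loaded_edge ld3).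
          case/andP=> /andP[/eqP fu euv] /eqP fv.
          apply: (@halts_weaken _ _ (1 + 1)%N 2%N _ _ _ _ (fun st h => h)) => //.
          apply/halts_Seq/halts_NSet/halts_NSet; rewrite /= c6' c7 c8 c9.
          split=> //; split=> //; split.
          + by do 2!apply: loaded_nset => //.
          + by [].
          + by move=> q w qp; rewrite /entry /= num_eq (negbTE qp); exact: oth3.
          + apply: (bfs_visit inv3 (u := u) (v := v)) => //.
            * by case: (edge u v) euv.
            * by rewrite -[LHS]/(nmem st3 4 _ _) fu addn1.
            * by move=> x; rewrite /entry /= eqxx num_eq addn2.
            * by move=> x; rewrite /entry /= eqxx num_eq.
            * move=> x y; rewrite /scan2 ltnS [(num y <= _)%N]leq_eqVlt (num_eq y).
              by case: (y == v); rewrite ?orbT ?orbF.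
        (* If the test fails, the arc from [u] to [v] is absent, starts off the current level, or
           ends at a reached vertex; no update is due. *)
        move=> no; apply: (@halts_weaken _ _ 1 2 _ _ _ _ (fun st h => h)) => //.
        apply: halts_Skip; split=> //; split=> //; split=> //.
        apply: bfs_scan_sub inv3 => x y fx exy.
        rewrite /scan2 ltnS [(num y <= _)%N]leq_eqVlt num_eq.
        case: (ltnP (num x) (num u)) => //= _; rewrite num_eq.
        have [xu|//] := eqVneq x u; have [yv _|_ /= -> //] := eqVneq y v.
        subst x y; rewrite ltnn lt0n; apply: contra no => fv.
        by rewrite exy -[nmem st3 4 _ (num u)]/(entry st3 4 p u) fx addn1 eqxx.
      - split=> //; apply: in_row_weaken inv2; apply: bfs_scan_sub => x y _ _.
        by rewrite /scan /scan2 ltn0 andbF orbF => ->.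
      - move=> st3 [inv3 h7 h8]; split=> //; split=> //.
        apply: in_row_weaken inv3; apply: bfs_scan_sub => x y _ _.
        by rewrite /scan /scan2 ltnS leq_eqVlt (num_lt y) andbT orbC => ->.
    * move=> st2 [inv2 h7]; split=> //; apply: in_row_weaken inv2.
      by apply: bfs_round => x y; exact: num_lt.
  + split=> //; first exact: loaded_nset.
    * by move=> q v qp; rewrite /entry /= num_eq (negbTE qp).
    * apply: bfs_init => v; rewrite /entry /= eqxx num_eq.
      by case: eqP => //= _; exact: zero0.
  + move=> st1 [ld1 h6 oth inv1]; split=> //; split=> //.
    * move=> q; rewrite ltnS leq_eqVlt num_eq; have [-> _|qp /=] := eqVneq q p.
        by apply: bfs_final inv1; exact: edge_connected.
      move=> /done0; have -> : entry st1 4 q = entry st0 4 q by apply/funext => v; case: (oth q v qp).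
      by have -> : entry st1 5 q = entry st0 5 q by apply/funext => v; case: (oth q v qp).
    * move=> q v pq; have qp : q != p by rewrite -num_eq gtn_eqF.
      by have [-> _] := oth q v qp; exact/zero0/ltnW.
- by move=> st' [ld' done _]; apply: post => // p; exact/done/num_lt.
Qed.

End FillTables.
End Correctness.

(** * Correctness of the rounds and total running time *)

Section MainLoop.
Context (R : realType) (I : instance R).
Notation V := (vertex I).
Notation T := (token I).
Implicit Types (st : state R) (c : T -> V) (out : seq (nat * nat)).
Implicit Types (p u v x y : V) (a b t : T).
Let n := #|V|.

Section Rounds.
Variables (dist : V -> V -> nat) (next : V -> V -> V).
Hypothesis tab : distance_table dist next.

Section Round.
Variable k17 : nat.

Record ready c out st : Prop := {
  ready_loaded : loaded c out st;
  ready_round : nmem st 17 0 0 = k17;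
  ready_dist p v : nmem st 4 (num p) (num v) = (dist p v).+1;
  ready_next p v : v != p -> nmem st 5 (num p) (num v) = num (next p v);
  ready_bound p v : (dist p v < n)%N
}.

Lemma ready_nset m i j k c out st : (5 < m < 17)%N ->
  ready c out st -> ready c out (nset st m i j k).
Proof.
move=> m5 [ld rk rd rn rb]; split=> //= *; first by apply: loaded_nset => //; lia.
- by rewrite gtn_eqF ?rk //; lia.
- by rewrite ltn_eqF ?rd //; lia.
- by rewrite ltn_eqF ?rn //; lia.
Qed.

Lemma ready_emit i j c out st : ready c out st -> ready c (rcons out (i, j)) (emit st i j).
Proof. by move=> [[? ? ? ? ? ho] *]; split=> //; split=> //=; rewrite ho. Qed.

(** No injectivity is asked of the configurations: between the two writes that record an exchange,
    both tokens are listed on the same vertex. *)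
Lemma ready_move c c' out st b i : (forall t, c' t = if t == b then i else c t) ->
  ready c out st -> ready c' out (nset st 2 (num b) 0 (num i)).
Proof.
move=> c'E [[? ? hp ? ? ?] *]; split=> //; split=> //= t.
by rewrite c'E num_eq andbT; case: eqP.
Qed.

(** The candidate is replaced only by a strictly lighter token, so ties stay with the smaller
    number, as [lighter] prescribes. *)
Lemma halts_find_lightest c out st (Q : state R -> Prop) : ready c out st ->
  (forall st', ready c out st' ->
     (nmem st' 10 0 0 = n /\ forall t, ~~ misplaced c t) \/
     (exists2 b, nmem st' 10 0 0 = num b & lightest c b) -> Q st') ->
  halts_within find_lightest (1 + n * (2 + 4)) st Q.
Proof.
move=> rdy post; apply/halts_Seq/halts_NSet => /=.
rewrite (loaded_size (ready_loaded rdy)).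
apply: (halts_For (n := n) (Inv := fun i st => ready c out st /\
     ((nmem st 10 0 0 = n /\ forall t, (num t < i)%N -> ~~ misplaced c t) \/
     (exists b, [/\ nmem st 10 0 0 = num b, misplaced c b, (num b < i)%N &
        forall t, (num t < i)%N -> misplaced c t -> lighter b t])))) => //.
- exact: n_gt0.
- by move=> i st1 [[/loaded_size]].
- by move=> i k st1 [r h]; split; first exact: ready_nset.
- move=> i st1 /num_token_surj [t <-] [r h] c11.
  have [ld _ _ _ _] := r.
  apply: halts_If; rewrite /= c11 (loaded_pos ld) (loaded_dest ld) (loaded_size ld)
    (loaded_weight ld) num_eq -/(misplaced c t).
    case/andP=> mt better; apply: halts_NSet => /=; rewrite c11; split=> //; split.
      exact: ready_nset.
    right; exists t; split=> // u; rewrite ltnS leq_eqVlt num_eq => /orP[/eqP -> _|ut mu].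
      by rewrite /lighter eqxx leqnn orbT.
    case: h => [[_ /(_ u ut)]|[b [c10 mb bt bmin]]]; first by rewrite mu.
    move: better; rewrite c10 (loaded_weight ld) negb_and negbK -ltNge.
    rewrite ltn_eqF /= => [tb|]; last exact: num_token_lt.
    by rewrite /lighter (lt_le_trans tb (lighter_weight (bmin u ut mu))).
  move=> no; apply: halts_Skip; split=> //; split=> //.
  case: h => [[c10 h]|[b [c10 mb bt bmin]]]; [left|right].
    split=> // u; rewrite ltnS leq_eqVlt num_eq => /orP[/eqP ->|/h //].
    by move: no; rewrite c10 eqxx /= andbT.
  exists b; split=> //; first exact: ltnW.
  move=> u; rewrite ltnS leq_eqVlt num_eq => /orP[/eqP ->|/bmin //] mt.
  move: no; rewrite mt c10 (loaded_weight ld) /= negbK => /andP[_].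
  by rewrite /lighter le_eqVlt orbC (ltnW bt) andbT.
- by split; [exact: ready_nset | left].
- move=> st' [r h]; apply: post => //.
  have lt_n := @num_token_lt R I.
  case: h => [[h1 h2]|[b [h1 h2 h3 h4]]]; [left|right].
    by split=> // t; exact: h2.
  by exists b => //; split=> // t; exact: h4.
Qed.

Section Exchange.
Variables (c : T -> V) (a b : T).
Hypotheses (ab : vf I a = c b) (cba : c a != c b).
Let p := c b.
Let x := c a.
Let l := dist p x.

Definition marked st : Prop := nmem st 10 0 0 = num b /\ nmem st 16 0 0 = num p.

Lemma halts_find_partner out st (Q : state R -> Prop) : ready c out st -> marked st ->
  (forall st', ready c out st' -> marked st' -> nmem st' 12 0 0 = num a -> Q st') ->
  halts_within find_partner (n * (2 + 4)) st Q.
Proof.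
move=> rdy mk post; apply: (halts_For (n := n) (Inv := fun i st => [/\ ready c out st, marked st
    & (num a < i)%N -> nmem st 12 0 0 = num a])) => //.
- exact: n_gt0.
- by move=> i st1 [[/loaded_size]].
- by move=> i k st1 [r h m]; split; first exact: ready_nset.
- move=> i st1 /num_token_surj [t <-] [r [m10 m16] h] c11.
  have [ld _ _ _ _] := r.
  have E : (vf I t == p) = (t == a) by rewrite /p -ab (inj_eq (bij_inj (vf_bij I))).
  apply: halts_If; rewrite /= c11 m16 (loaded_dest ld) num_eq E.
    move=> /eqP ta; apply: halts_NSet => /=; rewrite c11 ta; split=> //; split=> //.
    exact: ready_nset.
  move=> ta; apply: halts_Skip; split=> //; split=> //.
  by rewrite ltnS leq_eqVlt num_eq eq_sym (negbTE ta).
- move=> st' [r m h]; apply: post => //; apply: h.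
  exact: num_token_lt.
Qed.

Lemma dist_iter i : (i <= l)%N -> (dist p (iter i (next p) x) + i)%N = l.
Proof.
elim: i => [|i IH] il; first by rewrite addn0.
rewrite -(IH (ltnW il)) /= addnS -addSn -(next_dist tab) //.
by apply: contraTneq (il) => E; rewrite -(IH (ltnW il)) E (dist_refl tab) ltnn.
Qed.

Lemma halts_emit_path out st (Q : state R -> Prop) : ready c out st -> marked st ->
  nmem st 12 0 0 = num a ->
  (forall st', ready c (out ++ encode_swaps (path_swaps next p x l)) st' -> marked st' ->
     nmem st' 12 0 0 = num a -> Q st') ->
  halts_within emit_path (1 + (n * (1 + 1 + 4) + n * (1 + 4))) st Q.
Proof.
move=> rdy mk c12 post.
pose on_path k st := forall i, (i <= k)%N -> nmem st 13 i 0 = num (iter i (next p) x).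
have lenE out' st' : ready c out' st' -> marked st' -> nmem st' 12 0 0 = num a ->
    neval st' (NGet 4 (cell 16) (vec 2 (cell 12))) = l.+1.
  move=> r [_ m16] h; rewrite /= m16 h (loaded_pos (ready_loaded r)).
  exact: ready_dist r _ _.
have ln : (l < n)%N by exact: ready_bound rdy _ _.
apply/halts_Seq/halts_NSet/halts_Seq.
apply: (halts_For (n := l) (Inv := fun i st => [/\ ready c (out ++ encode_swaps (forward next p x i)) st,
    marked st, nmem st 12 0 0 = num a & on_path i st])) => //.
- exact: n_gt0.
- exact: ltnW.
- by move=> i st1 [r m h _]; have /= -> := lenE _ _ r m h; rewrite subn1.
- by move=> i k st1 [r m h o]; split=> //; exact: ready_nset.
- move=> i st1 il [r m h o] c14.
  have iNp : iter i (next p) x != p.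
    by apply: contraTneq (il) => E; rewrite -(dist_iter (ltnW il)) E (dist_refl tab) ltnn.
  apply/halts_Seq/halts_NSet/halts_Emit; cbv beta; rewrite forwardSr /=.
  rewrite c14 m.2 !addn1 !eqxx ltn_eqF //= (o i (leqnn i)) (ready_next r iNp).
  split=> //; split=> //.
        rewrite /encode_swaps map_rcons -rcons_cat /=.
    by apply: ready_emit; exact: ready_nset.
  move=> j; rewrite leq_eqVlt ltnS => /orP[/eqP -> /=|ji]; first by rewrite eqxx.
  by rewrite /= ltn_eqF //; exact: o.
- split=> //; first by rewrite cats0; exact: ready_nset.
  by move=> i; rewrite leqn0 => /eqP -> /=; rewrite c12 (loaded_pos (ready_loaded rdy)).
- move=> st1 [r1 m1 h1 o1].
  (* The way back reads the path stored in array 13; after i steps the first i entries of the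
     reversed list have been emitted. *)
  apply: (halts_For (n := l.-1) (Inv := fun i st => [/\
    ready c (out ++ encode_swaps (forward next p x l ++ take i (rev (forward next p x l.-1)))) st,
    marked st, nmem st 12 0 0 = num a & on_path l st])) => //.
  + exact: n_gt0.
  + by apply: leq_trans ln; exact/leqW/leq_pred.
  + by move=> i st2 [r m h _]; have /= -> := lenE _ _ r m h; lia.
  + by move=> i k st2 [r m h o]; split=> //; exact: ready_nset.
  + move=> i st2 il [r m h o] c14; apply/halts_Emit.
    have E k : neval st2 (vec 13 (NSub (NGet 4 (cell 16) (vec 2 (cell 12)))
         (NAdd (NConst k) (cell 14)))) = nmem st2 13 (l.+1 - (k + i)) 0.
      by rewrite -[LHS]/(nmem st2 13 (neval st2 (NGet 4 (cell 16) (vec 2 (cell 12))) -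
           (k + nmem st2 14 0 0)) 0) (lenE _ _ r m h) c14.
    rewrite !E !o; try lia.
    have si : (i < size (rev (forward next p x l.-1)))%N by rewrite size_rev size_mkseq.
    split=> //; split=> //.
    rewrite (take_nth (x, x) si) -rcons_cat /encode_swaps map_rcons -rcons_cat.
    rewrite nth_rev ?size_mkseq // nth_mkseq; last lia.
    have -> : (l.+1 - (3 + i) = l.-1 - i.+1)%N by lia.
    have -> : (l.+1 - (2 + i) = (l.-1 - i.+1).+1)%N by lia.
    exact: ready_emit.
  + by rewrite take0 cats0.
  + move=> st2 [r m h _]; apply: post => //.
    by rewrite take_oversize // in r; rewrite size_rev size_mkseq.
Qed.

Definition place_time : nat :=
  1 + (n * (2 + 4) + (1 + (n * (1 + 1 + 4) + n * (1 + 4)) + (1 + 1))).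

Lemma halts_place_partner out st (Q : state R -> Prop) : injective c ->
  ready c out st -> nmem st 10 0 0 = num b ->
  (forall st', ready (fun t => tperm x p (c t)) (out ++ encode_swaps (path_swaps next p x l)) st' ->
     Q st') ->
  halts_within place_partner place_time st Q.
Proof.
move=> cinj rdy c10 post; have ldp := loaded_pos (ready_loaded rdy).
apply/halts_Seq/halts_NSet/halts_Seq => /=; rewrite c10 ldp.
apply: (halts_find_partner (ready_nset _ _ _ _ rdy)) => // st1 r1 m1 h1.
apply/halts_Seq/(halts_emit_path r1 m1 h1) => st2 r2 m2 h2.
have a_b : a != b by apply: contraNneq cba => ->.
apply/halts_Seq/halts_NSet/halts_NSet => /=.
rewrite h2 m2.1 m2.2 (loaded_pos (ready_loaded r2)); apply: post.
apply: (ready_move (c := fun t => if t == b then x else c t)) (ready_move _ r2) => // t.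
have [->|ta] := eqVneq t a; first by rewrite tpermL.
have [->|tb] := eqVneq t b; first by rewrite tpermR.
by rewrite tpermD // (inj_eq cinj) eq_sym.
Qed.

End Exchange.
End Round.

Definition round_time : nat := 1 + n * (2 + 4) + place_time.+1.

Lemma halts_rounds k st (Q : state R -> Prop) : ready k (v0 I) [::] st ->
  (forall st' s, output st' = encode_swaps s -> progress dist s #|T| -> Q st') ->
  halts_within (For 17 (cell 0)
    (Seq find_lightest (If (BNEq (cell 10) (cell 0)) Skip place_partner)))
    (n * (round_time + 4)) st Q.
Proof.
move=> rdy post.
(* The value [k] of cell 17 is left open because the loop itself writes that cell; inside the body
   it is fixed to [i]. *)
apply: (halts_For (n := n) (Inv := fun i st => exists k s, progress dist s i
   /\ ready k (final (v0 I) s) (encode_swaps s) st)) => //.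
- exact: n_gt0.
- by move=> i st1 [k' [s [_ [/loaded_size]]]].
- move=> i k' st1 [k'' [s [ps [ld rk rd rn rb]]]]; exists k', s; split=> //.
  by split=> //; exact: loaded_nset.
- move=> i st1 iN [k' [s [ps r]]] c17.
  have {k'} r : ready i (final (v0 I) s) (encode_swaps s) st1 by case: r => *; split.
  set c := final (v0 I) s in r.
  have cinj : injective c by exact/bij_inj/final_bij/v0_bij.
  apply/halts_Seq/(halts_find_lightest r) => st2 r2 found.
  apply: halts_If; rewrite /= (loaded_size (ready_loaded r2)) => c10.
    apply: (@halts_weaken _ _ 1 place_time _ _ _ _ (fun st h => h)) => //.
    apply: halts_Skip; split; last exact: ready_round r2.
    exists i, s; split=> //; case: found => [[_ home]|[b h _]].
      by apply: progress_idle => //; rewrite (card_token I).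
    by move: c10 (num_lt b); rewrite h (card_token I) => /eqP ->; rewrite ltnn.
  case: found => [[h _]|[b h lb]]; first by rewrite h eqxx in c10.
  have [g _ Kg] := vf_bij I; pose a := g (c b); have ab : vf I a = c b by exact: Kg.
  have cba : c a != c b.
    rewrite (inj_eq cinj); apply: contraTneq lb.1 => E.
    by rewrite /misplaced negbK -ab E.
  apply: (halts_place_partner ab cba cinj r2 h) => st3 r3.
  split; last exact: ready_round r3.
  have [ps' fs'] := progress_step tab lb ab ps.
  exists i; eexists; split; first exact: ps'.
  rewrite /encode_swaps map_cat (_ : final _ _ = fun t => tperm (c a) (c b) (c t)) //.
  exact/funext.
- by exists k, [::]; split=> //; exact: progress0.
- by move=> st' [k' [s [ps [/loaded_output ho _ _ _ _]]]]; by apply: (post _ s); rewrite ?(card_token I).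
Qed.

End Rounds.

Lemma halts_token_swapping :
  halts_within token_swapping (fill_tables_time I + n * (round_time + 4)) (input I)
    (fun st => exists dist next (s : seq (V * V)), [/\ distance_table dist next,
       progress dist s #|T| & output st = encode_swaps s]).
Proof.
apply/halts_Seq/(halts_fill_tables (@loaded_input R I)) => // st ld tabs.
(* The default [v] of [nth] is irrelevant for [v != p], where the entry is the number of a vertex;
   at [v = p] the value of [next] is unconstrained. *)
pose dist p v := (entry st 4 p v).-1; pose next p v := nth v (enum V) (entry st 5 p v).
have fillE p v : entry st 4 p v = (dist p v).+1.
  by have [_ /(_ v) /andP[? _] _ _] := tabs p; rewrite prednK.
have nextP p v : v != p ->
    [/\ entry st 5 p v = num (next p v), edge v (next p v) & dist p v = (dist p (next p v)).+1].
  have [_ _ _ h] := tabs p; move=> /h [u [gu euv]]; rewrite !fillE => -[du].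
  by rewrite /next gu nth_enum_rank edge_sym.
have tab : distance_table dist next.
  split=> [p|p x y|p x /nextP[] //|p x /nextP[] //].
    by have [fp _ _ _] := tabs p; rewrite /dist fp.
  by have [_ _ h _] := tabs p; move=> /h; rewrite !fillE.
apply: (halts_rounds tab (k := nmem st 17 0 0)).
  split; first exact: ld.
  - by [].
  - exact: fillE.
  - by move=> p v /nextP[].
  - move=> p v; have [_ /(_ v) /andP[_ le_n] _ _] := tabs p.
    by rewrite fillE in le_n; exact: le_n.
by move=> st' s ho ps; exists dist, next, s.
Qed.

(** The left side is [7 n^4 + 4 n^3 + 27 n^2 + 15 n], and positivity of [n] lets [n^4] dominate the
    lower powers. *)
Lemma token_swapping_time : (fill_tables_time I + n * (round_time + 4) <= 100 * n ^ 4)%N.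
Proof.
rewrite /fill_tables_time /round_time /place_time -/n.
have := n_gt0 I; rewrite -/n !expnS expn0; move: n => m; nia.
Qed.

End MainLoop.

Theorem theorem3 (R : realType) :
  exists (p : program) (k d : nat), forall I : instance R,
    exists (t : nat) (st : state R) (s : seq (vertex I * vertex I)),
      [/\ exec p (input I) t st,
          (t <= k * #|vertex I| ^ d)%N,
          output st = encode_swaps s,
          valid s
        & forall w W OPT : R,
            is_min (weights I) w -> is_max (weights I) W ->
            is_min (valid_costs I) OPT ->
            cost s <= (2 + 2 * W / w) * OPT].
Proof.
exists token_swapping, 100%N, 4%N => I.
have [t [st [ex tle [dist [next [s [tab ps ho]]]]]]] := halts_token_swapping I.
have [vs cs] := progress_final tab ps.
by exists t, st, s; split=> //; exact: leq_trans (token_swapping_time I).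
Qed.
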